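(* Let $M,N\ge 1$ be integers, let $F_0,\ldots,F_N\in\mathbb{C}^{2M\times 2M}$, and let $F(\xi)=\sum_{j=0}^N F_j\xi^j$. Let $A,B,C,D$ be the matrices built from $F_0,\dots,F_N$ as in the context. Then $F$ satisfies the QMF-condition $$I-F^*(\xi)F(\xi)=0\quad\text{for all }\xi\in\mathbb{C},\ |\xi|=1,$$ if and only if the block matrix $$\begin{pmatrix}A&B\\ C&D\end{pmatrix}:\ \mathbb{C}^{2M}\oplus\mathbb{C}^{2MN}\to\mathbb{C}^{2M}\oplus\mathbb{C}^{2MN}$$ is unitary and $$F(\xi)=A+B\,\xi\,(I-D\xi)^{-1}C\quad\text{for all }\xi\in\mathbb{D}.$$
   Context: Notation: $\mathbb{D}=\{\xi\in\mathbb{C}:|\xi|<1\}$; $X^*$ is the conjugate transpose of a matrix $X$, and $F^*(\xi)=(F(\xi))^*=\sum_{j=0}^N F_j^*\bar\xi^{\,j}$; $I$ denotes identity matrices of the appropriate size. (In the application, $F_j=\sqrt2\begin{pmatrix}p_{2j}&q_{2j}\\ p_{2j+1}&q_{2j+1}\end{pmatrix}$, where $p_\alpha,q_\alpha\in\mathbb{C}^{M\times M}$, $\alpha\in\{0,\ldots,n\}$, are the coefficients of the scaling mask and of the multi-wavelet mask, and $N=\lfloor n/2\rfloor$.) Definition of $A,B,C,D$: The $2M(N+1)\times 2M(N+1)$ block matrix $\begin{pmatrix}A&B\\ C&D\end{pmatrix}$, with $A$ of size $2M\times 2M$, $B$ of size $2M\times 2MN$, $C$ of size $2MN\times 2M$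 and $D$ of size $2MN\times 2MN$, is $$\begin{pmatrix}A&B\\ C&D\end{pmatrix}=E\cdot\begin{pmatrix}I_{2M}&0\\ 0&U\end{pmatrix},$$ where $E$ is the block circulant matrix $$E=\begin{pmatrix}F_0&F_N&\cdots&\cdots&F_1\\ F_1&F_0&F_N&&\vdots\\ \vdots&F_1&\ddots&\ddots&\vdots\\ \vdots&&\ddots&\ddots&F_N\\ F_N&F_{N-1}&\cdots&F_1&F_0\end{pmatrix},$$ that is, with block indices $i,j\in\{0,\dots,N\}$, the $(i,j)$ block of $E$ is $F_{(i-j)\bmod (N+1)}$; and $U$ is the $2MN\times2MN$ block circulant matrix $$U=\begin{pmatrix}F_0^*+F_N^*&F_1^*&\cdots&F_{N-1}^*\\ F_{N-1}^*&\ddots&\ddots&\vdots\\ \vdots&\ddots&\ddots&F_1^*\\ F_1^*&\cdots&F_{N-1}^*&F_0^*+F_N^*\end{pmatrix},$$ that is, with block indices $i,j\in\{1,\dots,N\}$, the $(i,i)$ blocks are $F_0^*+F_N^*$ and, for $i\ne j$, the $(i,j)$ block is $F^*_{(j-i)\bmod N}$ (for $N=1$, $U=F_0^*+F_1^*$). *)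

(* Defs.v *)
From mathcomp Require Import all_boot all_order all_algebra.
From mathcomp Require Import sesquilinear spectral.
From mathcomp Require Import complex reals.

Set Implicit Arguments.
Unset Strict Implicit.
Unset Printing Implicit Defensive.

Import GRing.Theory Num.Theory.
Local Open Scope ring_scope.
Local Open Scope sesquilinear_scope.

Section Realization.
Variables (K : numClosedFieldType) (m N : nat).
Variable F : 'I_N.+1 -> 'M[K]_m.

Definition matpoly (xi : K) : 'M[K]_m := \sum_(j < N.+1) xi ^+ j *: F j.

Definition QMF : Prop :=
  forall xi : K, `|xi| = 1 -> 1%:M - (matpoly xi)^t* *m matpoly xi = 0.

(* [Eblk i j] is meant for i, j <= N; adding N.+1 keeps the truncated
   subtraction exact. *)
Definition Eblk (i j : nat) : 'M[K]_m := F (inord ((i + N.+1 - j) %% N.+1)).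

(* Block row and block column 0 are split off, so that the dimension of E is
   syntactically m + \sum_(i < N) m and no cast is needed. *)
Definition Emx : 'M[K]_(m + \sum_(i < N) m) :=
  block_mx (Eblk 0 0) (\mxrow_(j < N) Eblk 0 j.+1)
           (\mxcol_(i < N) Eblk i.+1 0) (\mxblock_(i < N, j < N) Eblk i.+1 j.+1).

(* The blocks are numbered from 0 rather than from 1; only the difference of
   the indices matters. *)
Definition Umx : 'M[K]_(\sum_(i < N) m) :=
  \mxblock_(i < N, j < N)
    (if i == j then (F ord0)^t* + (F ord_max)^t*
     else (F (inord ((j + N - i) %% N)))^t*).

Definition sysmx : 'M[K]_(m + \sum_(i < N) m) :=
  Emx *m block_mx 1%:M 0 0 Umx.

Definition sysA : 'M[K]_m := ulsubmx sysmx.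
Definition sysB : 'M[K]_(m, \sum_(i < N) m) := ursubmx sysmx.
Definition sysC : 'M[K]_(\sum_(i < N) m, m) := dlsubmx sysmx.
Definition sysD : 'M[K]_(\sum_(i < N) m) := drsubmx sysmx.

End Realization.

(* Main.v *)
Require Import Defs.
From mathcomp Require Import all_boot all_order all_algebra.
From mathcomp Require Import sesquilinear spectral.
From mathcomp Require Import complex reals.
From mathcomp Require Import ring zify.

Set Implicit Arguments.
Unset Strict Implicit.
Unset Printing Implicit Defensive.

Import Order.TTheory GRing.Theory Num.Theory.
Local Open Scope ring_scope.

(** The condition that F is unitary on the unit circle says that the
    autocorrelation of the coefficients, [\sum_a F_a^* F_(a+d)], is 1 for d = 0
    and 0 for every other shift d: a trigonometric polynomial that vanishes on
    the circle has zero coefficients ([QMF_polyP], [QMF_autocorr]).  As the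
    matrices are square, the same holds for [\sum_a F_a F_(a+d)^*]
    ([QMF_reversed]).

    From QMF to the realization.  Extend the coefficients by zero to all integer
    indices ([tap]), and let T c be the N x N block Toeplitz matrix with blocks
    F_(c+i-j) ([toep]).  With L = T 0 and V = T N, the circulant U^* is L + V and
    the lower right corner of E is L + T (N+1).  Sums over windows that contain
    the support of F turn autocorrelation into the relations
    L^* L + V^* V = 1, V^* L = 0 and T c L^* = 0 for c >= N.
    They make U unitary; the circulant E, of N+1 blocks, is unitary by the same
    computation with wrap-around at N+1 ([QMF_fold]).  They also give
    U V = V^* V, hence D V = T (N+1) ([sysD_toep]), and B V is the first block
    row of V ([sysB_toep]).  So V intertwines D with a shift, and the state
    (1 - xi D)^-1 C has an explicit form: its blocks are the iterated backward
    shifts of the polynomial F, [\sum_k F_(i+1+k) xi^k] ([state_equation]); the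
    output equation then returns F(xi).  Invertibility of 1 - xi D in the disc
    holds because D is a corner of a unitary matrix, thus a contraction.

    Conversely, the realization identity is an identity of rational functions of
    xi, so it extends from the disc to every xi at which 1 - xi D is invertible
    ([transfer_extends]).  At such points of the circle, unitarity of the block
    matrix makes the transfer function an isometry ([unitary_transfer]).  Only
    finitely many points of the circle are left out; after multiplication by xi^N
    the QMF condition is polynomial on the circle, so it holds at these points
    as well ([QMF_generic]). *)

(** * Adjoints and block matrices *)

Local Open Scope sesquilinear_scope.

Section Adjoint.
Variable K : numClosedFieldType.

Lemma adjmxM m n p (A : 'M[K]_(m, n)) (B : 'M[K]_(n, p)) :
  (A *m B)^t* = B^t* *m A^t*.
Proof. by rewrite trmx_mul map_mxM. Qed.

Lemma adjmxD m n (A B : 'M[K]_(m, n)) : (A + B)^t* = A^t* + B^t*.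
Proof. by rewrite linearD map_mxD. Qed.

Lemma adjmx0 m n : (0 : 'M[K]_(m, n))^t* = 0.
Proof. by rewrite trmx0 map_mx0. Qed.

Lemma adjmx1 n : (1%:M : 'M[K]_n)^t* = 1%:M.
Proof. by rewrite trmx1 map_mx1. Qed.

Lemma adjmxZ m n a (A : 'M[K]_(m, n)) : (a *: A)^t* = a^* *: A^t*.
Proof. by rewrite linearZ map_mxZ. Qed.

Lemma adjmx_sum m n (I : Type) (r : seq I) (P : pred I) (G : I -> 'M[K]_(m, n)) :
  (\sum_(i <- r | P i) G i)^t* = \sum_(i <- r | P i) (G i)^t*.
Proof. by rewrite linear_sum raddf_sum. Qed.

Lemma adj_mxblock p q m n (G : 'I_p -> 'I_q -> 'M[K]_(m, n)) :
  (\mxblock_(i, j) G i j)^t* = \mxblock_(j, i) (G i j)^t*.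
Proof. by rewrite tr_mxblock; apply/matrixP=> i j; rewrite !mxE. Qed.

Lemma adj_mxrow q m n (G : 'I_q -> 'M[K]_(m, n)) :
  (\mxrow_j G j)^t* = \mxcol_j (G j)^t*.
Proof. by rewrite tr_mxrow; apply/matrixP=> i j; rewrite !mxE. Qed.

Lemma adj_mxcol p m n (G : 'I_p -> 'M[K]_(m, n)) :
  (\mxcol_j G j)^t* = \mxrow_j (G j)^t*.
Proof. by rewrite tr_mxcol; apply/matrixP=> i j; rewrite !mxE. Qed.

Lemma mxblock1 p m :
  \mxblock_(i < p, j < p) ((i == j)%:R%:M : 'M[K]_m) = 1%:M.
Proof.
rewrite -(mxdiagZ (p_ := fun=> m)); apply/eq_mxblock=> i j.
by rewrite conform_mx_id; case: eqP => // _; rewrite raddf0.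
Qed.

Lemma scale_mxcol p m n a (G : 'I_p -> 'M[K]_(m, n)) :
  a *: \mxcol_j G j = \mxcol_j (a *: G j).
Proof. by apply/matrixP=> i j; rewrite !mxE. Qed.

End Adjoint.

(** * Polynomials vanishing on the disc or on the circle *)

Section Vanishing.
Variable K : numClosedFieldType.

Lemma poly_eq0_inj (p : {poly K}) (z : nat -> K) :
  injective z -> (forall n, p.[z n] = 0) -> p = 0.
Proof.
move=> z_inj pz; apply: (@roots_geq_poly_eq0 _ _ [seq z n | n <- iota 0 (size p)]).
- by apply/allP=> _ /mapP[n _ ->]; apply/eqP/pz.
- by rewrite map_inj_uniq ?iota_uniq.
- by rewrite size_map size_iota.
Qed.

Lemma poly_eq0_disc (p : {poly K}) :
  (forall z : K, `|z| < 1 -> p.[z] = 0) -> p = 0.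
Proof.
move=> p0; apply: (@poly_eq0_inj _ (fun n => n.+2%:R^-1)) => [a b /invr_inj|n].
  by move/eqP; rewrite eqr_nat => /eqP[].
apply: p0; rewrite normfV normr_nat invf_lt1 ?ltr1n ?ltr0n //.
Qed.

Lemma poly_eq0_circle (p : {poly K}) :
  (forall z : K, `|z| = 1 -> p.[z] = 0) -> p = 0.
Proof.
have dn0 (n : nat) : n%:R - 'i != 0 :> K.
  rewrite subr_eq0; apply/eqP=> ni; have := @nonRealCi K.
  by rewrite -ni realn.
have sn0 (n : nat) : n%:R + 'i != 0 :> K.
  rewrite addr_eq0 -eqr_oppLR; apply/eqP=> ni; have := @nonRealCi K.
  by rewrite -ni realN realn.
(* The Cayley transform maps the natural numbers injectively to the circle. *)
move=> p0; apply: (@poly_eq0_inj _ (fun n => (n%:R + 'i) / (n%:R - 'i))).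
  move=> a b; move/eqP; rewrite eqr_div ?dn0 // => /eqP e.
  have : 'i * 2 * (b%:R - a%:R) = 0 :> K.
    have: (a%:R + 'i) * (b%:R - 'i) - (b%:R + 'i) * (a%:R - 'i) = 0 :> K.
      by rewrite e; ring.
    by move=> <-; ring.
  move/eqP; rewrite !mulf_eq0 (negPf (neq0Ci _)) pnatr_eq0 /= subr_eq0 eqr_nat.
  by move/eqP.
move=> n; apply: p0; rewrite normf_div.
have -> : n%:R - 'i = (n%:R + 'i)^* :> K by rewrite rmorphD /= conjCi conjC_nat.
by rewrite norm_conjC divff // normr_eq0 sn0.
Qed.
End Vanishing.

(** * Transfer functions *)

Section Transfer.
Variables (K : numClosedFieldType) (m n : nat).
Variables (A : 'M[K]_m) (B : 'M[K]_(m, n)) (C : 'M[K]_(n, m)) (D : 'M[K]_n).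

Let charq : {poly K} := \det (1%:M - 'X *: map_mx polyC D).

Lemma horner_charq xi : charq.[xi] = \det (1%:M - xi *: D).
Proof.
rewrite -horner_evalE -det_map_mx map_mxB map_mx1 map_mxZ -map_mx_comp.
rewrite /= !horner_evalE hornerX; congr (\det (_ - _ *: _)).
by apply/matrixP=> i j; rewrite !mxE /= horner_evalE hornerC.
Qed.

(** The value at 0 is 1. *)
Lemma charq_neq0 : charq != 0.
Proof.
apply/eqP=> q0; have := horner_charq 0; rewrite q0 horner0 scale0r subr0 det1.
by move/eqP; rewrite eq_sym oner_eq0.
Qed.

(** Multiplied by [\det (1 - xi D)], the identity becomes polynomial in [xi],
    because the inverse turns into the adjugate; a polynomial that vanishes on
    the disc is zero. *)
Lemma transfer_extends N (F : 'I_N.+1 -> 'M[K]_m) :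
  (forall xi : K, `|xi| < 1 ->
     (1%:M - xi *: D) \in unitmx /\
     matpoly F xi = A + xi *: (B *m invmx (1%:M - xi *: D) *m C)) ->
  forall xi : K, (1%:M - xi *: D) \in unitmx ->
     matpoly F xi = A + xi *: (B *m invmx (1%:M - xi *: D) *m C).
Proof.
move=> trF.
pose Fp : 'M[{poly K}]_m := \sum_(j < N.+1) 'X^j *: map_mx polyC (F j).
pose G := 1%:M - 'X *: map_mx polyC D.
pose P := charq *: (Fp - map_mx polyC A)
          - 'X *: (map_mx polyC B *m \adj G *m map_mx polyC C).
have evC p q (H : 'M[K]_(p, q)) (xi : K) : map_mx (horner_eval xi) (map_mx polyC H) = H.
  by apply/matrixP=> i j; rewrite !mxE /= horner_evalE hornerC.
have evP xi : map_mx (horner_eval xi) P =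
    \det (1%:M - xi *: D) *: (matpoly F xi - A)
    - xi *: (B *m \adj (1%:M - xi *: D) *m C).
  pose f : {rmorphism {poly K} -> K} := horner_eval xi.
  have fX : f 'X = xi by rewrite /f /= horner_evalE hornerX.
  have fG : map_mx f G = 1%:M - xi *: D.
    by rewrite map_mxB map_mx1 map_mxZ evC fX.
  have fF : map_mx f Fp = matpoly F xi.
    rewrite map_mx_sum; apply: eq_bigr => j _.
    by rewrite map_mxZ evC rmorphXn fX.
  rewrite -[horner_eval xi]/(f : _ -> _) map_mxB !map_mxZ map_mxB !map_mxM map_mx_adj.
  by rewrite fX fG fF !evC /f /= horner_evalE horner_charq.
have invE xi : (1%:M - xi *: D) \in unitmx ->
    invmx (1%:M - xi *: D) = (\det (1%:M - xi *: D))^-1 *: \adj (1%:M - xi *: D).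
  by rewrite /invmx => ->.
have P0 : P = 0.
  apply/matrixP=> i j; rewrite [RHS]mxE; apply: poly_eq0_disc => xi /trF[u Fxi].
  have := congr1 (fun H : 'M_m => H i j) (evP xi); rewrite mxE horner_evalE => ->.
  rewrite Fxi [A + _]addrC addrK invE // -scalemxAr -scalemxAl !scalerA mulrCA.
  rewrite divff ?mulr1 ?subrr ?mxE //.
  by rewrite -unitfE -unitmxE.
move=> xi u; apply/eqP; rewrite -subr_eq0 opprD addrA; apply/eqP.
have d0 : \det (1%:M - xi *: D) != 0 by rewrite -unitfE -unitmxE.
apply: (scalerI d0); rewrite scaler0 scalerBr invE // -scalemxAr -scalemxAl !scalerA.
by rewrite mulrCA divff // mulr1 -evP P0 map_mx0.
Qed.

Hypothesis W_unitary : block_mx A B C D \is unitarymx.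

(** If v = xi v D, then comparing the norms of (0, v) and (0, v) W = (v C, v D)
    gives |v C|^2 + |v D|^2 = |xi|^2 |v D|^2, which forces v D = 0, so v = 0. *)
Lemma unitary_contraction xi : `|xi| < 1 -> (1%:M - xi *: D) \in unitmx.
Proof.
move=> xi1; rewrite unitmxE unitfE; apply/det0P=> -[v v0 vD].
pose sq p (u : 'rV[K]_p) := \sum_i `|u 0 i| ^+ 2.
have sqE p (u : 'rV[K]_p) : (u *m u^t*) 0 0 = sq p u.
  by rewrite mxE; apply: eq_bigr => i _; rewrite !mxE normCK.
have sq_ge0 p (u : 'rV[K]_p) : 0 <= sq p u.
  by apply: sumr_ge0 => i _; rewrite exprn_ge0.
have vE : v = xi *: (v *m D).
  by apply/eqP; rewrite -subr_eq0 scalemxAr -[X in X - _]mulmx1 -mulmxBr vD.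
have : sq _ (v *m C) + sq _ (v *m D) = sq _ v.
  rewrite -!sqE.
  transitivity ((row_mx (v *m C) (v *m D) *m (row_mx (v *m C) (v *m D))^t*) 0 0).
    by rewrite tr_row_mx map_col_mx mul_row_col [RHS]mxE.
  have -> : row_mx (v *m C) (v *m D) = row_mx 0 v *m block_mx A B C D.
    by rewrite mul_row_block !mul0mx !add0r.
  rewrite adjmxM mulmxA -[_ *m _ *m (block_mx _ _ _ _)^t*]mulmxA.
  by rewrite (unitarymxP _) // mulmx1 tr_row_mx map_col_mx mul_row_col mul0mx add0r.
have -> : sq _ v = `|xi| ^+ 2 * sq _ (v *m D).
  rewrite [in LHS]vE mulr_sumr; apply: eq_bigr => i _.
  by rewrite mxE normrM exprMn.
move=> e.
have p0 : sq _ (v *m D) = 0.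
  apply/eqP; rewrite eq_le sq_ge0 andbT.
  have x2 : 0 < 1 - `|xi| ^+ 2 by rewrite subr_gt0 expr_lt1.
  rewrite -(pmulr_rle0 _ x2) mulrBl mul1r -e opprD addrCA subrr addr0 oppr_le0.
  exact: sq_ge0.
case/negP: v0; rewrite vE; apply/eqP/rowP=> i; rewrite !mxE.
move/eqP: p0; rewrite psumr_eq0 => [/allP/(_ i)|j _]; last by rewrite exprn_ge0.
rewrite mem_index_enum => /(_ isT) /=; rewrite sqrf_eq0 normr_eq0 => /eqP.
by rewrite mxE => ->; rewrite mulr0.
Qed.

(** With X = (1 - xi D)^-1 C, the block matrix maps (1, xi X) to (T, X); since
    |xi| = 1, the contributions of X to the norms of both sides cancel. *)
Lemma unitary_transfer xi : `|xi| = 1 -> (1%:M - xi *: D) \in unitmx ->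
  let T := A + xi *: (B *m invmx (1%:M - xi *: D) *m C) in T^t* *m T = 1%:M.
Proof.
move=> xi1 u T; pose X := invmx (1%:M - xi *: D) *m C.
have WX : block_mx A B C D *m col_mx 1%:M (xi *: X) = col_mx T X.
  rewrite mul_block_col !mulmx1 -!scalemxAr /T /X mulmxA; congr col_mx.
  apply/eqP; rewrite eq_sym -subr_eq scalemxAl -[X in X - _]mul1mx -mulmxBl.
  by rewrite mulmxA mulmxV // mul1mx.
have WW : (block_mx A B C D)^t* *m block_mx A B C D = 1%:M.
  by apply/mulmx1C/unitarymxP.
have : (col_mx T X)^t* *m col_mx T X = 1%:M + X^t* *m X.
  rewrite -WX adjmxM mulmxA -[_ *m _ *m block_mx _ _ _ _]mulmxA WW mulmx1.
  rewrite tr_col_mx map_row_mx mul_row_col adjmx1 mul1mx adjmxZ.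
  by rewrite -scalemxAl -scalemxAr scalerA mulrC -normCK xi1 expr1n scale1r.
rewrite tr_col_mx map_row_mx mul_row_col; exact: addIr.
Qed.

End Transfer.

(** * The QMF condition on coefficients *)

Section QMF.
Variables (K : numClosedFieldType) (m N : nat).
Implicit Types F : 'I_N.+1 -> 'M[K]_m.

(** On the circle the conjugate of xi is its inverse; the factor xi^N clears the
    negative powers from the entries of F^* F - 1. *)
Definition qmf_poly F i j : {poly K} :=
  \sum_(a < N.+1) \sum_(b < N.+1) ((F a)^t* *m F b) i j *: 'X^(N - a + b)
  - (i == j)%:R *: 'X^N.

Lemma circle_exprB (xi : K) n k : `|xi| = 1 -> (k <= n)%N ->
  xi ^+ n * xi^* ^+ k = xi ^+ (n - k).
Proof.
move=> xi1 kn; rewrite -{1}(subnK kn) exprD -mulrA -exprMn -normCK xi1.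
by rewrite !expr1n mulr1.
Qed.

Lemma horner_qmf_poly F i j xi : `|xi| = 1 ->
  (qmf_poly F i j).[xi] = - (xi ^+ N * (1%:M - (matpoly F xi)^t* *m matpoly F xi) i j).
Proof.
move=> xi1.
rewrite /qmf_poly hornerD hornerN hornerZ hornerXn !mxE mulrBr opprB.
congr (_ - _); last by rewrite mulrC.
transitivity (xi ^+ N * ((matpoly F xi)^t* *m matpoly F xi) i j); last by rewrite mxE.
rewrite adjmx_sum mulmx_suml summxE mulr_sumr horner_sum; apply: eq_bigr => a _.
rewrite mulmx_sumr summxE mulr_sumr horner_sum; apply: eq_bigr => b _.
rewrite hornerZ hornerXn adjmxZ -scalemxAl -scalemxAr scalerA [in RHS]mxE.
by rewrite mulrA mulrA rmorphXn circle_exprB -1?ltnS // exprD mulrC.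
Qed.

Lemma QMF_polyP F : QMF F <-> forall i j, qmf_poly F i j = 0.
Proof.
split=> [qmf i j|p0 xi xi1].
  apply: poly_eq0_circle => xi xi1.
  by rewrite horner_qmf_poly // qmf // mxE mulr0 oppr0.
apply/matrixP=> i j; have := horner_qmf_poly F i j xi1.
move/esym/eqP; rewrite p0 horner0 oppr_eq0 mulf_eq0 expf_eq0.
have /negPf-> : xi != 0 by rewrite -normr_eq0 xi1 oner_eq0.
by rewrite andbF /= => /eqP ->; rewrite mxE.
Qed.

(** The product of q with an entry of the QMF defect vanishes on the whole
    circle, and polynomials over a field have no zero divisors. *)
Lemma QMF_generic F (q : {poly K}) : q != 0 ->
  (forall xi : K, `|xi| = 1 -> q.[xi] != 0 ->
     1%:M - (matpoly F xi)^t* *m matpoly F xi = 0) -> QMF F.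
Proof.
move=> q0 qmf; apply/QMF_polyP=> i j.
have /eqP : q * qmf_poly F i j = 0.
  apply: poly_eq0_circle => xi xi1; rewrite hornerM.
  have [->|qx] := eqVneq q.[xi] 0; first by rewrite mul0r.
  by rewrite horner_qmf_poly // qmf // mxE mulr0 oppr0 mulr0.
by rewrite mulf_eq0 (negPf q0) => /eqP.
Qed.

(** On the circle, the reversed family of adjoints has the polynomial
    xi^N F(xi)^*, and F(xi) F(xi)^* = 1 because F(xi) is square.  This exchanges
    column relations with row relations. *)
Lemma QMF_reversed F : QMF F -> QMF (fun a => (F (rev_ord a))^t*).
Proof.
move=> qmf xi xi1.
have -> : matpoly (fun a => (F (rev_ord a))^t*) xi = xi ^+ N *: (matpoly F xi)^t*.
  rewrite /matpoly (reindex_inj rev_ord_inj) adjmx_sum scaler_sumr.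
  apply: eq_bigr => a _; rewrite rev_ordK adjmxZ scalerA /= subSS rmorphXn.
  by rewrite circle_exprB -1?ltnS.
have FF : matpoly F xi *m (matpoly F xi)^t* = 1%:M.
  by apply/mulmx1C/esym/eqP; rewrite -subr_eq0; apply/eqP/qmf.
rewrite adjmxZ trmxCK -scalemxAl -scalemxAr FF scalerA rmorphXn -exprMn mulrC.
by rewrite -normCK xi1 !expr1n scale1r subrr.
Qed.

(** The coefficients extended by zero to all integer indices, so that sums over
    shifted windows need no bookkeeping at the boundary. *)
Definition tap F (z : int) : 'M[K]_m := \sum_(a < N.+1 | a%:Z == z) F a.

Lemma tap_ord F (a : 'I_N.+1) : tap F a = F a.
Proof.
rewrite /tap (big_pred1 a) // => b; rewrite /= -val_eqE /=; lia.
Qed.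

Lemma tap_out F (z : int) : (z < 0) || (N%:Z < z) -> tap F z = 0.
Proof.
move=> zo; rewrite /tap big1 // => a /eqP az.
have := ltn_ord a; move: zo; rewrite -az; lia.
Qed.

Lemma tap_reversed F z : tap (fun a => (F (rev_ord a))^t*) z = (tap F (N%:Z - z))^t*.
Proof.
rewrite /tap adjmx_sum (reindex_inj rev_ord_inj); apply: eq_big => a.
  by have := ltn_ord a; rewrite /=; lia.
by rewrite rev_ordK.
Qed.

(** Entrywise, the difference of the two sides is the coefficient of 'X^(N + d)
    in [qmf_poly]; for d < -N all terms of the sum are zero. *)
Lemma QMF_autocorr F (d : int) : QMF F ->
  \sum_(a < N.+1) (F a)^t* *m tap F (a%:Z + d) = (d == 0)%:R%:M.
Proof.
move=> /QMF_polyP qmf; have [dN|dN] := ltP d (- N%:Z).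
  rewrite big1 => [|a _]; last first.
    rewrite tap_out ?mulmx0 //; have := ltn_ord a; lia.
  have -> : (d == 0) = false by lia.
  by rewrite raddf0.
apply/matrixP=> i j.
have := congr1 (fun p : {poly K} => p`_(absz (N%:Z + d))) (qmf i j).
rewrite coef0 coefB coefZ coefXn coef_sum => /eqP; rewrite subr_eq0 => /eqP e.
transitivity (((i == j)%:R * (absz (N%:Z + d) == N :> nat)%:R) : K); last first.
  rewrite !mxE mulr_natr; have -> : (absz (N%:Z + d) == N) = (d == 0) by lia.
  by case: eqP; case: eqP => //; rewrite ?mulr1n ?mulr0n // mul0rn.
rewrite -e summxE; apply: eq_bigr => a _.
rewrite coef_sum /tap mulmx_sumr summxE.
rewrite [RHS](bigID (fun b : 'I_N.+1 => b%:Z == a%:Z + d)) /=.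
rewrite [X in _ = _ + X]big1 ?addr0 => [|b /negPf ne]; last first.
  rewrite coefZ coefXn.
  have -> : (absz (N%:Z + d) == (N - a + b)%N) = false; last by rewrite mulr0.
  have := ltn_ord a; lia.
apply: eq_bigr => b /eqP be; rewrite coefZ coefXn.
have -> : (absz (N%:Z + d) == (N - a + b)%N) = true; last by rewrite mulr1.
have := ltn_ord a; lia.
Qed.

(** When the window [0, n) contains the overlap of the supports of the two
    shifted copies of F, the sum is a full autocorrelation. *)
Lemma QMF_window F n (s t : int) : QMF F ->
  (forall z : int, 0 <= z - s <= N%:Z -> 0 <= z - t <= N%:Z -> 0 <= z < n%:Z) ->
  \sum_(k < n) (tap F (k%:Z - s))^t* *m tap F (k%:Z - t) = (s == t)%:R%:M.
Proof.
move=> qmf supp; have -> : (s == t) = (s - t == 0) by lia.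
rewrite -(QMF_autocorr _ qmf) {1}/tap.
under eq_bigr => k _ do rewrite adjmx_sum mulmx_suml.
rewrite (exchange_big_dep predT) //=; apply: eq_bigr => a _.
have an := ltn_ord a.
have [o|o] := boolP (0 <= a%:Z + s < n%:Z).
  have kn : (absz (a%:Z + s)%R < n)%N by lia.
  rewrite (big_pred1 (Ordinal kn)) => [|k]; last by rewrite /= -val_eqE /=; lia.
  by congr (_ *m tap F _); rewrite /=; lia.
rewrite big1 => [|k /eqP ak]; last by have := ltn_ord k; move: o; lia.
rewrite tap_out ?mulmx0 //; have := supp (a%:Z + s); lia.
Qed.

Lemma QMF_window_adj F n (s t : int) : QMF F ->
  (forall z : int, 0 <= s - z <= N%:Z -> 0 <= t - z <= N%:Z -> 0 <= z < n%:Z) ->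
  \sum_(k < n) tap F (s - k%:Z) *m (tap F (t - k%:Z))^t* = (s == t)%:R%:M.
Proof.
move=> /QMF_reversed qmf supp.
have -> : (s == t) = (s - N%:Z == t - N%:Z) by lia.
rewrite -(QMF_window (n := n) qmf) => [|z zs zt]; last by apply: supp; lia.
apply: eq_bigr => k _; rewrite !tap_reversed trmxCK.
by congr (tap F _ *m (tap F _)^t*); lia.
Qed.

End QMF.

(** * The block Toeplitz relations *)

Section Circulant.
Variables (K : numClosedFieldType) (m N : nat) (F : 'I_N.+1 -> 'M[K]_m).
Hypothesis qmf : QMF F.

Local Notation t := (tap F).

(** Both sums together run over the window [0, 2n), which contains the support
    of every column. *)
Lemma QMF_columns n (i j : 'I_n) : (N <= n)%N ->
  \sum_(k < n) (t (k%:Z - i%:Z))^t* *m t (k%:Z - j%:Z) +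
  \sum_(k < n) (t (n%:Z + k%:Z - i%:Z))^t* *m t (n%:Z + k%:Z - j%:Z)
  = (i == j)%:R%:M.
Proof.
move=> Nn; have [li lj] := (ltn_ord i, ltn_ord j).
have -> : (i == j) = (i%:Z == j%:Z) by [].
by rewrite -(QMF_window (n := n + n) qmf) ?big_split_ord //= => z; lia.
Qed.

Lemma QMF_columns_cross n (i j : 'I_n) : (N <= n)%N ->
  \sum_(k < n) (t (n%:Z + k%:Z - i%:Z))^t* *m t (k%:Z - j%:Z) = 0.
Proof.
move=> Nn; have [li lj] := (ltn_ord i, ltn_ord j).
transitivity ((i%:Z - n%:Z == j%:Z)%:R%:M : 'M[K]_m).
  rewrite -(QMF_window (n := n) qmf) => [|z]; last by lia.
  by apply: eq_bigr => k _; congr ((t _)^t* *m _); lia.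
have -> : (i%:Z - n%:Z == j%:Z) = false by lia.
by rewrite raddf0.
Qed.

(** The block circulant of the coefficients wrapped modulo n >= N has orthonormal
    columns.  The case n = N + 1 is E, and the case n = N is the adjoint of U. *)
Lemma QMF_fold n (i j : 'I_n) : (N <= n)%N ->
  \sum_(k < n) (t (k%:Z - i%:Z) + t (n%:Z + k%:Z - i%:Z))^t* *m
               (t (k%:Z - j%:Z) + t (n%:Z + k%:Z - j%:Z))
  = (i == j)%:R%:M.
Proof.
move=> Nn.
have cross : \sum_(k < n) (t (k%:Z - i%:Z))^t* *m t (n%:Z + k%:Z - j%:Z) = 0.
  have := congr1 (fun A : 'M_m => A^t*) (QMF_columns_cross j i Nn).
  rewrite adjmx0 adjmx_sum => e; rewrite -[RHS]e.
  by apply: eq_bigr => k _; rewrite adjmxM trmxCK.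
under eq_bigr => k _ do rewrite adjmxD mulmxDl !mulmxDr.
by rewrite !big_split /= QMF_columns_cross // add0r cross addr0 QMF_columns.
Qed.

Lemma QMF_rows (s : int) (l : 'I_N) : N%:Z <= s ->
  \sum_(k < N) t (s - k%:Z) *m (t (l%:Z - k%:Z))^t* = 0.
Proof.
move=> Ns; have ll := ltn_ord l.
rewrite (QMF_window_adj qmf) => [|z]; last by lia.
have -> : (s == l%:Z) = false by lia.
by rewrite raddf0.
Qed.

(** Cut into N x N arrays of blocks, the infinite block Toeplitz operator of F is
    bidiagonal: [toep 0] is its diagonal entry, [toep N] the one below. *)
Definition toep (c : int) : 'M[K]_(\sum_(i < N) m) :=
  \mxblock_(i < N, j < N) t (c + i%:Z - j%:Z).

Lemma adj_toep c : (toep c)^t* = \mxblock_(i < N, j < N) (t (c + j%:Z - i%:Z))^t*.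
Proof. exact: adj_mxblock. Qed.

Lemma toep_columns : (toep 0)^t* *m toep 0 + (toep N)^t* *m toep N = 1%:M.
Proof.
rewrite !adj_toep !mul_mxblock -mxblockD -mxblock1; apply: eq_mxblock => i j.
under eq_bigr => k _ do rewrite !add0r.
exact: QMF_columns.
Qed.

Lemma toep_columns_cross : (toep N)^t* *m toep 0 = 0.
Proof.
rewrite adj_toep mul_mxblock -mxblock0; apply: eq_mxblock => i j.
under eq_bigr => k _ do rewrite !add0r.
exact: QMF_columns_cross.
Qed.

Lemma toep_rows (c : int) : N%:Z <= c -> toep c *m (toep 0)^t* = 0.
Proof.
move=> Nc; rewrite adj_toep mul_mxblock -mxblock0; apply: eq_mxblock => i j.
under eq_bigr => k _ do rewrite !add0r.
by apply: QMF_rows; lia.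
Qed.

Lemma row_toep_rows :
  (\mxrow_(j < N) t (N%:Z - j%:Z)) *m (toep 0)^t* = 0.
Proof.
rewrite adj_toep mul_mxrow_mxblock -mxrow0; apply: eq_mxrow => j.
under eq_bigr => k _ do rewrite !add0r.
exact: QMF_rows.
Qed.

(** * The circulants and their unitarity *)

Lemma tap_inord k : (k <= N)%N -> F (inord k) = t k.
Proof. by move=> kN; rewrite -tap_ord inordK. Qed.

Lemma EblkE i j : (i <= N)%N -> (j <= N)%N ->
  Eblk F i j = t (i%:Z - j%:Z) + t (N.+1%:Z + i%:Z - j%:Z).
Proof.
move=> iN jN; rewrite /Eblk; have [ji|ij] := leqP j i.
  have -> : (i + N.+1 - j = i - j + N.+1)%N by lia.
  rewrite modnDr modn_small ?tap_inord; try lia.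
  rewrite [X in _ + X]tap_out ?addr0; last by lia.
  by congr t; lia.
rewrite modn_small ?tap_inord; try lia.
rewrite [X in X + _]tap_out ?add0r; last by lia.
by congr t; lia.
Qed.

Lemma UmxE : Umx F = (toep 0 + toep N)^t*.
Proof.
rewrite adjmxD !adj_toep -mxblockD; apply: eq_mxblock => i j.
have [li lj] := (ltn_ord i, ltn_ord j).
rewrite add0r; case: eqP => [->|/eqP ne].
  by rewrite subrr addrK -[ord_max]inord_val -[ord0]inord_val !tap_inord //=.
have {}ne : (i : nat) != j by [].
rewrite -adjmxD; congr (_^t*).
have [ij|ji] := leqP i j.
  have -> : (j + N - i = j - i + N)%N by lia.
  rewrite modnDr modn_small ?tap_inord; try lia.
  rewrite [X in _ + X]tap_out ?addr0; last by lia.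
  by congr t; lia.
rewrite modn_small ?tap_inord; try lia.
rewrite [X in X + _]tap_out ?add0r; last by lia.
by congr t; lia.
Qed.

Lemma Emx_unitary : Emx F \is unitarymx.
Proof.
have ortho i j : (i <= N)%N -> (j <= N)%N ->
    (Eblk F 0 i)^t* *m Eblk F 0 j + \sum_(k < N) (Eblk F k.+1 i)^t* *m Eblk F k.+1 j
    = (i == j)%:R%:M.
  move=> iN jN; have := @QMF_fold N.+1 (inord i) (inord j) (leqnSn N).
  rewrite -(inj_eq val_inj) /= !inordK // => <-.
  rewrite big_ord_recl -!EblkE //; congr (_ + _).
  by apply: eq_bigr => k _; rewrite -!EblkE //= ltn_ord.
rewrite -trmxC_unitary; apply/unitarymxP; rewrite trmxCK /Emx.
rewrite tr_block_mx map_block_mx adj_mxrow adj_mxcol adj_mxblock mulmx_block.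
rewrite mul_mxrow_mxcol mul_mxrow mul_mxrow_mxblock mxcol_mul mul_mxblock_mxrow.
rewrite mul_mxcol_mxrow mul_mxblock -mxrowD -mxcolD -mxblockD scalar_mx_block.
congr block_mx.
- by rewrite ortho.
- by rewrite -mxrow0; apply: eq_mxrow => j; rewrite ortho //= raddf0.
- by rewrite -mxcol0; apply: eq_mxcol => j; rewrite ortho //= raddf0.
- by rewrite -mxblock1; apply: eq_mxblock => i j; rewrite ortho.
Qed.

Lemma Umx_unitary : Umx F \is unitarymx.
Proof.
apply/unitarymxP; rewrite UmxE trmxCK adjmxD mulmxDl !mulmxDr.
rewrite toep_columns_cross add0r addrAC toep_columns.
have := congr1 (fun A : 'M_(\sum_(i < N) m) => A^t*) toep_columns_cross.
by rewrite adjmxM trmxCK adjmx0 => ->; rewrite addr0.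
Qed.

Lemma sysmx_unitary : sysmx F \is unitarymx.
Proof.
apply: mul_unitarymx Emx_unitary _; apply/unitarymxP.
rewrite tr_block_mx map_block_mx !trmx0 !map_mx0 adjmx1 mulmx_block.
rewrite !(mul0mx, mulmx0, mulmx1, addr0, add0r) (unitarymxP Umx_unitary).
by rewrite -scalar_mx_block.
Qed.

Lemma sysmxE : sysmx F =
  block_mx (t 0) ((\mxrow_(j < N) t (N%:Z - j%:Z)) *m Umx F)
    (\mxcol_(i < N) t i.+1) ((toep 0 + toep N.+1) *m Umx F).
Proof.
rewrite /sysmx /Emx mulmx_block !(mulmx0, mulmx1, addr0, add0r).
have lt (k : 'I_N) := ltn_ord k.
congr block_mx.
- by rewrite EblkE // subr0 addr0 [X in _ + X]tap_out ?addr0 //; lia.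
- congr (_ *m _); apply: eq_mxrow => j; rewrite EblkE // [X in X + _]tap_out ?add0r.
    by congr t; lia.
  by lia.
- apply: eq_mxcol => i; rewrite EblkE // subr0 [X in _ + X]tap_out ?addr0 //; lia.
- congr (_ *m _); rewrite -mxblockD; apply: eq_mxblock => i j; rewrite EblkE //.
  by congr (t _ + t _); lia.
Qed.

(** * The state of the realization *)

Lemma Umx_toep : Umx F *m toep N = (toep N)^t* *m toep N.
Proof.
rewrite UmxE adjmxD mulmxDl.
have := congr1 (fun A : 'M_(\sum_(i < N) m) => A^t*) toep_columns_cross.
by rewrite adjmxM trmxCK adjmx0 => ->; rewrite add0r.
Qed.

(** Only the part T (N+1) of the corner of E sees the range of V^* V, since
    L V^* = 0, and there V^* V = 1 - L^* L acts as the identity, since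
    T (N+1) L^* = 0. *)
Lemma sysD_toep : sysD F *m toep N = toep N.+1.
Proof.
rewrite /sysD sysmxE block_mxKdr -mulmxA Umx_toep mulmxDl mulmxA.
have := congr1 (fun A : 'M_(\sum_(i < N) m) => A^t*) (toep_rows (lexx N%:Z)).
rewrite adjmxM trmxCK adjmx0 => ->; rewrite mul0mx add0r.
rewrite -[RHS]mulmx1 -toep_columns mulmxDr [toep N.+1 *m (_ *m toep 0)]mulmxA.
by rewrite toep_rows ?mul0mx ?add0r //; lia.
Qed.

Lemma sysB_toep : sysB F *m toep N = \mxrow_(j < N) t (N%:Z - j%:Z).
Proof.
rewrite /sysB sysmxE block_mxKur -mulmxA Umx_toep.
rewrite -[RHS]mulmx1 -toep_columns mulmxDr [X in _ = X + _]mulmxA.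
by rewrite row_toep_rows mul0mx add0r.
Qed.

Variable xi : K.

(** Descending powers: [toep N *m powcol] then has the i-th block
    [\sum_k xi^k F_(i+1+k)], a backward shift of F. *)
Definition powcol : 'M[K]_(\sum_(i < N) m, m) := \mxcol_(j < N) (xi ^+ (N - j.+1))%:M.

Lemma powcolE (s : int) :
  \sum_(j < N) t (s - j%:Z) *m (xi ^+ (N - j.+1))%:M =
  \sum_(k < N) xi ^+ k *: t (s + 1 - N%:Z + k%:Z).
Proof.
rewrite (reindex_inj rev_ord_inj); apply: eq_bigr => k _.
have lk := ltn_ord k; rewrite mul_mx_scalar /=.
by congr (xi ^+ _ *: t _); lia.
Qed.

(** For s > 0 the coefficient at s + N is zero, so the sum may be extended by one
    term and its first term split off. *)
Lemma tail_shift (s : int) : 0 < s ->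
  \sum_(k < N) xi ^+ k *: t (s + k%:Z) =
  t s + xi *: \sum_(k < N) xi ^+ k *: t (s + 1 + k%:Z).
Proof.
move=> s0; transitivity (\sum_(k < N.+1) xi ^+ k *: t (s + k%:Z)).
  by rewrite big_ord_recr /= [t (s + N%:Z)]tap_out ?scaler0 ?addr0 //; lia.
rewrite big_ord_recl /= addr0 scale1r; congr (_ + _).
rewrite scaler_sumr; apply: eq_bigr => k _.
by rewrite scalerA -exprS; congr (_ *: t _); rewrite /= /bump; lia.
Qed.

Lemma matpoly_tail :
  matpoly F xi = t 0 + xi *: \sum_(k < N) xi ^+ k *: t (1 + k%:Z).
Proof.
rewrite /matpoly; under eq_bigr => k _ do rewrite -tap_ord.
rewrite big_ord_recl scale1r; congr (_ + _).
rewrite scaler_sumr; apply: eq_bigr => k _.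
by rewrite scalerA -exprS; congr (_ *: t _); rewrite /= /bump; lia.
Qed.

Lemma state_equation :
  (1%:M - xi *: sysD F) *m (toep N *m powcol) = sysC F.
Proof.
rewrite mulmxBl mul1mx -scalemxAl [sysD F *m _]mulmxA sysD_toep.
rewrite /sysC sysmxE block_mxKdl; apply/eqP; rewrite subr_eq; apply/eqP.
rewrite !mul_mxblock_mxrow scale_mxcol -mxcolD; apply: eq_mxcol => i.
rewrite !powcolE.
transitivity (\sum_(k < N) xi ^+ k *: t (i.+1%:Z + k%:Z)).
  by apply: eq_bigr => k _; congr (_ *: t _); lia.
rewrite tail_shift //; congr (_ + _ *: _).
by apply: eq_bigr => k _; congr (_ *: t _); lia.
Qed.

Lemma output_equation :
  sysA F + xi *: (sysB F *m (toep N *m powcol)) = matpoly F xi.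
Proof.
rewrite mulmxA sysB_toep /powcol mul_mxrow_mxcol powcolE /sysA sysmxE block_mxKul.
rewrite matpoly_tail; congr (_ + _ *: _); apply: eq_bigr => k _.
by congr (_ *: t _); lia.
Qed.

Lemma QMF_realization : (1%:M - xi *: sysD F) \in unitmx ->
  matpoly F xi =
    sysA F + xi *: (sysB F *m invmx (1%:M - xi *: sysD F) *m sysC F).
Proof.
by move=> u; rewrite -output_equation -state_equation -mulmxA mulKmx.
Qed.

End Circulant.

(** * The equivalence *)

Lemma sysmx_blocks (K : numClosedFieldType) m N (F : 'I_N.+1 -> 'M[K]_m) :
  block_mx (sysA F) (sysB F) (sysC F) (sysD F) = sysmx F.
Proof. exact: submxK. Qed.

Theorem theorem2p7 (R : realType) (M N : nat) (hM : (0 < M)%N) (hN : (0 < N)%N)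
    (F : 'I_N.+1 -> 'M[R[i]]_(2 * M)) :
  QMF F <->
  block_mx (sysA F) (sysB F) (sysC F) (sysD F) \is unitarymx /\
  (forall xi : R[i], `|xi| < 1 ->
     (1%:M - xi *: sysD F) \in unitmx /\
     matpoly F xi =
       sysA F + xi *: (sysB F *m invmx (1%:M - xi *: sysD F) *m sysC F)).
Proof.
split=> [qmf|[W trF]].
  have W : block_mx (sysA F) (sysB F) (sysC F) (sysD F) \is unitarymx.
    by rewrite sysmx_blocks; apply: sysmx_unitary.
  split=> // xi /(unitary_contraction W) u; split=> //.
  exact: QMF_realization.
apply: (QMF_generic (charq_neq0 (sysD F))) => xi xi1.
rewrite horner_charq -unitfE -unitmxE => u.
rewrite (transfer_extends trF u); apply/eqP; rewrite subr_eq0 eq_sym; apply/eqP.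
exact: unitary_transfer.
Qed.
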